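(* Let $K$ be an algebraically closed field. For every positive integer $m$, there exist a basic finite-dimensional $K$-algebra $A_m$ and a stratifying system $(\Theta_m,\leq)$ of finite size $s_m$ in $\mathrm{mod}\,A_m$ such that $s_m > m\cdot \mathrm{rk}(K_0(A_m))$.
   Context: For a finite-dimensional $K$-algebra $A$, $\mathrm{mod}\,A$ is the category of finitely generated right $A$-modules, $K_0(A)$ is the Grothendieck group of $A$ (i.e. of the abelian category $\mathrm{mod}\,A$), and $\mathrm{rk}(K_0(A))$ is its rank, which equals the number of isomorphism classes of simple $A$-modules. A stratifying system of finite size $t\in\mathbb{N}$ in $\mathrm{mod}\,A$ is a pair $(\Theta,\leq)$ where $\Theta=\{\theta_i : i\in[1,t]\}$ is a family of indecomposable objects of $\mathrm{mod}\,A$ and $\leq$ is a linear order on the set $[1,t]=\{1,\dots,t\}$ such that $\mathrm{Hom}_A(\theta_j,\theta_i)=0$ if $i<j$ and $\mathrm{Ext}^1_A(\theta_j,\theta_i)=0$ if $i\leq j$, where $i<j$ and $i\leq j$ refer to the given linear order. *)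

(* Defs.v *)
From HB Require Import structures.
From mathcomp Require Import all_boot all_order all_algebra all_field.
Set Implicit Arguments.
Unset Strict Implicit.
Unset Printing Implicit Defensive.
Import GRing.Theory.
Local Open Scope ring_scope.

(* The category of finitely generated left R-modules.  Right A-modules are
   left modules over the converse ring A^c: for a : A^c and v in the module,
   a *: v is the right action v a. *)

Definition finitely_generated (R : nzRingType) (M : lmodType R) : Prop :=
  exists (n : nat) (g : 'I_n -> M),
    forall v : M, exists a : 'I_n -> R, v = \sum_(i < n) a i *: g i.

Record fgmod (R : nzRingType) := FgMod {
  fgmod_sort :> lmodType R;
  fgmodP : finitely_generated fgmod_sort
}.

Definition rmod (K : fieldType) (A : falgType K) := fgmod A^c.

Definition mod_zero (R : nzRingType) (M : lmodType R) : Prop :=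
  forall v : M, v = 0.

Definition mod_iso (R : nzRingType) (M N : lmodType R) : Prop :=
  exists f : {linear M -> N}, bijective f.

Lemma finitely_generated_prod (R : nzRingType) (M N : lmodType R) :
  finitely_generated M -> finitely_generated N ->
  finitely_generated (M * N)%type.
Proof.
move=> [m [g gP]] [n [h hP]].
exists (m + n)%N, (fun i => match split i with
                            | inl j => (g j, 0) | inr j => (0, h j) end).
move=> [v w]; have [a ->] := gP v; have [b ->] := hP w.
exists (fun i => match split i with inl j => a j | inr j => b j end).
have splitl (i : 'I_m) : split (lshift n i) = inl i := unsplitK (inl i).
have splitr (j : 'I_n) : split (rshift m j) = inr j := unsplitK (inr j).
rewrite big_split_ord /=.
rewrite (eq_bigr (fun i => a i *: (g i, 0 : N))); last first.
  by move=> i _; rewrite splitl.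
rewrite [X in _ + X](eq_bigr (fun j => b j *: (0 : M, h j))); last first.
  by move=> j _; rewrite splitr.
apply/pair_equal_spec; split; rewrite /= !raddf_sum /=.
- by rewrite [X in _ + X]big1 ?addr0 // => j _; rewrite scaler0.
- by rewrite [X in X + _]big1 ?add0r // => i _; rewrite scaler0.
Qed.

Definition fgmod_prod (R : nzRingType) (M N : fgmod R) : fgmod R :=
  FgMod (finitely_generated_prod (fgmodP M) (fgmodP N)).

Definition indecomposable (R : nzRingType) (M : fgmod R) : Prop :=
  ~ mod_zero M /\
  forall M1 M2 : fgmod R,
    mod_iso M (fgmod_prod M1 M2) -> mod_zero M1 \/ mod_zero M2.

Definition Hom_vanishes (R : nzRingType) (M N : fgmod R) : Prop :=
  forall (f : {linear M -> N}) (v : M), f v = 0.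

(* Extensions 0 -> N -> E -> M -> 0 in the category of finitely generated
   modules; Ext^1(M, N) is the group of their Yoneda classes, whose zero
   element is the class of the split extension. *)
Record extension (R : nzRingType) (M N : fgmod R) := Extension {
  ext_mid : fgmod R;
  ext_in : {linear N -> ext_mid};
  ext_out : {linear ext_mid -> M};
  ext_in_inj : injective ext_in;
  ext_out_surj : forall w : M, exists x : ext_mid, ext_out x = w;
  ext_exact : forall x : ext_mid, ext_out x = 0 <-> exists u : N, x = ext_in u
}.

Definition ext_equiv (R : nzRingType) (M N : fgmod R)
    (X Y : extension M N) : Prop :=
  exists h : {linear ext_mid X -> ext_mid Y},
    [/\ bijective h,
        forall u : N, h (ext_in X u) = ext_in Y u
      & forall x : ext_mid X, ext_out Y (h x) = ext_out X x].

Definition pair0 (R : nzRingType) (M N : lmodType R) (u : N) : (N * M)%type :=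
  (u, 0).

Lemma pair0_is_linear (R : nzRingType) (M N : lmodType R) :
  linear (@pair0 R M N).
Proof.
by move=> a u v; apply/pair_equal_spec; rewrite /= scaler0 addr0.
Qed.

HB.instance Definition _ (R : nzRingType) (M N : lmodType R) :=
  GRing.isLinear.Build R N (N * M)%type *:%R (@pair0 R M N)
    (@pair0_is_linear R M N).

Lemma pair0_inj (R : nzRingType) (M N : lmodType R) : injective (@pair0 R M N).
Proof. by move=> u v [->]. Qed.

Lemma snd_surj (R : nzRingType) (M N : lmodType R) (w : M) :
  exists x : (N * M)%type, x.2 = w.
Proof. by exists (0, w). Qed.

Lemma pair0_snd_exact (R : nzRingType) (M N : lmodType R) (x : (N * M)%type) :
  x.2 = 0 <-> exists u : N, x = pair0 M u.
Proof.
by case: x => u w; split=> [/= -> | [v [_ ->]]] //; exists u.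
Qed.

Definition split_extension (R : nzRingType) (M N : fgmod R) : extension M N :=
  @Extension R M N (fgmod_prod N M) (@pair0 R M N) (@snd N M)
    (@pair0_inj R M N) (@snd_surj R M N) (@pair0_snd_exact R M N).

Definition Ext1_vanishes (R : nzRingType) (M N : fgmod R) : Prop :=
  forall X : extension M N, ext_equiv X (split_extension M N).

Definition linear_order (T : Type) (le : rel T) : Prop :=
  [/\ reflexive le, antisymmetric le, transitive le & total le].

Definition stratifying_system (K : fieldType) (A : falgType K) (t : nat)
    (theta : 'I_t -> rmod A) (le : rel 'I_t) : Prop :=
  [/\ linear_order le,
      forall i : 'I_t, indecomposable (theta i),
      forall i j : 'I_t, le i j -> i <> j -> Hom_vanishes (theta j) (theta i)
    & forall i j : 'I_t, le i j -> Ext1_vanishes (theta j) (theta i)].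

(* The Grothendieck group, presented by generators [M] and relations
   [E] = [N] + [M] for every exact sequence 0 -> N -> E -> M -> 0: its
   elements are the group words in the generators, and K0_eq is equality in
   the group.  It is kept as a setoid since its generators range over a large
   type, which rules out a zmodType structure in the universe of modules. *)
Inductive K0_word (R : nzRingType) :=
  | K0_zero
  | K0_opp of K0_word R
  | K0_add of K0_word R & K0_word R
  | K0_class of fgmod R.
Arguments K0_zero {R}.

Inductive K0_eq (R : nzRingType) : K0_word R -> K0_word R -> Prop :=
  | K0_refl x : K0_eq x x
  | K0_sym x y : K0_eq x y -> K0_eq y x
  | K0_trans x y z : K0_eq x y -> K0_eq y z -> K0_eq x z
  | K0_opp_congr x y : K0_eq x y -> K0_eq (K0_opp x) (K0_opp y)
  | K0_add_congr x x' y y' :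
      K0_eq x x' -> K0_eq y y' -> K0_eq (K0_add x y) (K0_add x' y')
  | K0_addA x y z : K0_eq (K0_add x (K0_add y z)) (K0_add (K0_add x y) z)
  | K0_addC x y : K0_eq (K0_add x y) (K0_add y x)
  | K0_add0 x : K0_eq (K0_add K0_zero x) x
  | K0_addN x : K0_eq (K0_add (K0_opp x) x) K0_zero
  | K0_exact (M N : fgmod R) (X : extension M N) :
      K0_eq (K0_class (ext_mid X)) (K0_add (K0_class N) (K0_class M)).

Definition K0_mulz (R : nzRingType) (c : int) (x : K0_word R) : K0_word R :=
  match c with
  | Posz n => iter n (K0_add x) K0_zero
  | Negz n => K0_opp (iter n.+1 (K0_add x) K0_zero)
  end.

Definition K0_independent (R : nzRingType) (r : nat) (x : 'I_r -> K0_word R) :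
    Prop :=
  forall c : 'I_r -> int,
    K0_eq (\big[@K0_add R/K0_zero]_(i < r) K0_mulz (c i) (x i)) K0_zero ->
    forall i : 'I_r, c i = 0.

Definition K0_rank (R : nzRingType) (r : nat) : Prop :=
  (exists x : 'I_r -> K0_word R, K0_independent x) /\
  (forall (s : nat) (x : 'I_s -> K0_word R), K0_independent x -> (s <= r)%N).

Definition rk_K0 (K : fieldType) (A : falgType K) (r : nat) : Prop :=
  K0_rank A^c r.

Definition idempotent_elt (A : nzRingType) (e : A) : Prop := e * e = e.

Definition primitive_idempotent (A : nzRingType) (e : A) : Prop :=
  [/\ idempotent_elt e, e <> 0
    & forall e1 e2 : A,
        idempotent_elt e1 -> idempotent_elt e2 ->
        e1 * e2 = 0 -> e2 * e1 = 0 -> e = e1 + e2 -> e1 = 0 \/ e2 = 0].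

Definition complete_primitive_idempotents (A : nzRingType) (n : nat)
    (e : 'I_n -> A) : Prop :=
  [/\ forall i : 'I_n, primitive_idempotent (e i),
      forall i j : 'I_n, i <> j -> e i * e j = 0
    & \sum_(i < n) e i = 1].

(* For e idempotent, {x | e x = x} is the right ideal e A, here as a submodule
   of the regular right module; the product e * x is that of A. *)
Definition in_eA (A : nzRingType) (e : A) : {pred (A^c)^o} :=
  [pred x : A | e * x == x].

Lemma in_eA_submod (A : nzRingType) (e : A) : submod_closed (in_eA e).
Proof.
split=> [|a x y]; rewrite !inE /= ?mulr0 // => /eqP ex /eqP ey.
change (e * ((x : A) * (a : A) + y) == (x : A) * (a : A) + y :> A).
by rewrite mulrDr mulrA ex ey.
Qed.

HB.instance Definition _ (A : nzRingType) (e : A) :=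
  GRing.isSubmodClosed.Build A^c (A^c)^o (in_eA e) (in_eA_submod e).

Record eA (A : nzRingType) (e : A) := EA {
  eA_val :> (A^c)^o;
  eA_valP : eA_val \in in_eA e
}.
HB.instance Definition _ (A : nzRingType) (e : A) :=
  [isSub for @eA_val A e].
HB.instance Definition _ (A : nzRingType) (e : A) :=
  [Choice of eA e by <:].
HB.instance Definition _ (A : nzRingType) (e : A) :=
  [SubChoice_isSubLmodule of eA e by <:].

Definition basic_algebra (K : fieldType) (A : falgType K) : Prop :=
  exists (n : nat) (e : 'I_n -> A),
    complete_primitive_idempotents e /\
    forall i j : 'I_n, i <> j -> ~ @mod_iso A^c (eA (e i)) (eA (e j)).

(* Main.v *)
Require Import Defs.
From HB Require Import structures.
From mathcomp Require Import all_boot all_order all_algebra all_field.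
From mathcomp Require Import ring.
From Stdlib Require Import Setoid Morphisms Classical ClassicalEpsilon.
Set Implicit Arguments.
Unset Strict Implicit.
Unset Printing Implicit Defensive.
Import GRing.Theory VectorInternalTheory.
Local Open Scope ring_scope.

(* Let [A] be the algebra of upper triangular 3x3 matrices over the product
   ring [K^(n+1)] whose diagonal entries are scalars from [K]; it has three
   simple modules, whatever [n] is.  For each coordinate [j] let [a_j] be the
   matrix with the basis vector [delta_j] in position (1,2) and zeros elsewhere,
   and put [M_j = e_1 A / a_j A].  These [n + 1] modules form a stratifying
   system for any order: a map [M_j -> M_i] sends the generator to a multiple of
   the generator killed by [a_j], hence to 0 if [i <> j]; and if [y] lifts the
   generator of [M_j] to an extension by [M_i], then [y a_j] lies in
   [M_i e_2 = K^n] and is killed by [delta_k] in position (2,3) for all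
   [k <> j], because [a_j] is, so it is a multiple of [delta_j], and [y] can be
   corrected by a multiple of the generator of [M_i] so that [y a_j = 0]. *)

(** * Finite-dimensional linear algebra *)

Section LinearAlgebra.
Context {K : fieldType} {W : lmodType K}.

(** Modules over [A] come without a chosen basis, so their finite-dimensional subspaces are
    described by injective linear maps from row spaces, built with this map. *)
Definition row_comb d (w : 'I_d -> W) (x : 'rV[K]_d) : W :=
  \sum_i x 0 i *: w i.

Fact row_comb_is_linear d (w : 'I_d -> W) : linear (row_comb w).
Proof.
move=> c x y; rewrite /row_comb scaler_sumr -big_split /=.
by apply: eq_bigr => i _; rewrite !mxE scalerDl scalerA.
Qed.

HB.instance Definition _ d (w : 'I_d -> W) :=
  GRing.isLinear.Build K 'rV[K]_d W *:%R (row_comb w) (row_comb_is_linear w).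

Lemma row_combE d (g : {linear 'rV[K]_d -> W}) x :
  g x = row_comb (fun i => g (delta_mx 0 i)) x.
Proof.
rewrite {1}[x]row_sum_delta linear_sum.
by apply: eq_bigr => i _; rewrite linearZ.
Qed.

Lemma linear_inj d (g : {linear 'rV[K]_d -> W}) :
  (forall x, g x = 0 -> x = 0) -> injective g.
Proof.
by move=> g0 x y gxy; apply/subr0_eq/g0; rewrite linearB gxy subrr.
Qed.

(** Lifts to [V] of the images of the basis vectors are independent, because [f] carries a relation
    between them to one between values of [g]. *)
Lemma leq_dim_lift (V : vectType K) (f : {linear V -> W}) d
    (g : {linear 'rV[K]_d -> W}) :
  injective g -> (forall x, exists v, f v = g x) -> (d <= dim V)%N.
Proof.
move=> g_inj fg.
have [v fv] := fin_all_exists (fun i => fg (delta_mx 0 i)).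
pose B := \matrix_i v2r (v i).
suff /eqP <- : row_free B by apply: rank_leq_col.
apply: inj_row_free => x xB0; apply: g_inj.
rewrite linear0 row_combE /row_comb.
under eq_bigr do rewrite -fv.
under eq_bigr do rewrite -linearZ.
rewrite -linear_sum /=.
suff -> : \sum_i x 0 i *: v i = 0 by rewrite linear0.
apply: v2r_inj; rewrite linear0 linear_sum -[RHS]xB0 mulmx_sum_row.
by apply: eq_bigr => i _; rewrite linearZ rowK.
Qed.

Lemma max_exists (Q : nat -> Prop) b :
  Q 0%N -> (forall d, Q d -> (d <= b)%N) -> exists d, Q d /\ ~ Q d.+1.
Proof.
move=> Q0 Qb; apply: NNPP => nQ.
suff /Qb : Q b.+1 by rewrite ltnn.
elim: b.+1 => // d Qd; apply: NNPP => nQd; apply: nQ; by exists d.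
Qed.

(** By [leq_dim_lift] there is a largest [d] admitting an injective map into [P]; a vector of [P]
    missed by such a map would extend it by one dimension. *)
Lemma subspace_parametrization (V : vectType K) (f : {linear V -> W})
    (P : W -> Prop) :
  P 0 -> (forall c u v, P u -> P v -> P (c *: u + v)) ->
  (forall w, P w -> exists v, f v = w) ->
  exists d (g : {linear 'rV[K]_d -> W}),
    injective g /\ forall w, P w <-> exists x, g x = w.
Proof.
move=> P0 Plin Pf.
pose Q d := exists g : {linear 'rV[K]_d -> W}, injective g /\ forall x, P (g x).
have Q0 : Q 0%N.
  exists (row_comb (fun i : 'I_0 => 0)); split.
    by move=> x y _; rewrite !thinmx0.
  by move=> x; rewrite (thinmx0 x) linear0.
have Qb d : Q d -> (d <= dim V)%N.
  by case=> g [g_inj Pg]; apply: leq_dim_lift g_inj _ => x; apply: Pf.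
have [d [[g [g_inj Pg]] nQ]] := max_exists Q0 Qb.
exists d, g; split=> // w; split=> [Pw|[x <-]] //.
apply: NNPP => nw; apply: nQ.
pose h : {linear 'rV[K]_(1 + d) -> W} := row_comb (fun i : 'I_(1 + d) =>
   match split i with inl _ => w | inr j => g (delta_mx 0 j) end).
have hE (x : 'rV_(1 + d)) : h x = x 0 (lshift d 0) *: w + g (rsubmx x).
  rewrite /h /= /row_comb big_split_ord /= big_ord1 (unsplitK (inl _)).
  congr (_ + _); rewrite row_combE; apply: eq_bigr => i _.
  by rewrite (unsplitK (inr _)) mxE.
suff h_inj (x : 'rV_(1 + d)) : h x = 0 -> x = 0.
  by exists h; split=> [|x]; [apply: linear_inj | rewrite hE; apply: Plin].
rewrite hE => hx0.
(* A nonzero coefficient of [w] would put [w] in the image of [g]. *)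
have x0 : x 0 (lshift d 0) = 0.
  apply/eqP; apply: contraT => nz; case: nw.
  exists (- ((x 0 (lshift d 0))^-1 *: rsubmx x)).
  rewrite linearN linearZ /= -[g _](addKr (x 0 (lshift d 0) *: w)) hx0 addr0.
  by rewrite scalerN opprK scalerA mulVf // scale1r.
have rx0 : rsubmx x = 0.
  by apply: g_inj; rewrite linear0 -hx0 x0 scale0r add0r.
rewrite -[x]hsubmxK rx0; apply/rowP => i; rewrite mxE [RHS]mxE.
case: splitP => j ij; last by rewrite mxE.
by rewrite mxE -x0 (ord1 j).
Qed.

End LinearAlgebra.

(** * Dimensions of the components [M e] *)

Section ScalarRestriction.
Context {K : fieldType} {A : falgType K}.

(** The underlying vector space over [K], with [c] acting as [c%:A]; the alias keeps this action
    apart from that of [A^c]. *)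
Definition restrict (M : lmodType A^c) : Type := M.

HB.instance Definition _ (M : lmodType A^c) := GRing.Zmodule.on (restrict M).

Section Instance.
Context {M : lmodType A^c}.

Definition restrict_scale (c : K) (v : restrict M) : restrict M :=
  (c%:A : A^c) *: (v : M).

Fact restrict_scalerA c d v :
  restrict_scale c (restrict_scale d v) = restrict_scale (c * d) v.
Proof.
rewrite /restrict_scale scalerA; congr (_ *: _).
by rewrite /GRing.mul /= -[LHS]/(d%:A * c%:A : A) -scalerAl mul1r scalerA mulrC.
Qed.

Fact restrict_scale1r : left_id 1 restrict_scale.
Proof. by move=> v; rewrite /restrict_scale scale1r [LHS]scale1r. Qed.

Fact restrict_scalerDr : right_distributive restrict_scale +%R.
Proof. by move=> c u v; rewrite /restrict_scale [LHS]scalerDr. Qed.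

Fact restrict_scalerDl v : {morph restrict_scale^~ v : a b / a + b}.
Proof. by move=> a b; rewrite /restrict_scale scalerDl [LHS]scalerDl. Qed.

HB.instance Definition _ := GRing.Zmodule_isLmodule.Build K (restrict M)
  restrict_scalerA restrict_scale1r restrict_scalerDr restrict_scalerDl.

Lemma restrictZ (c : K) (v : restrict M) :
  c *: v = (c%:A : A^c) *: (v : M) :> M.
Proof. by []. Qed.

Lemma ractM (a b : A) (v : M) :
  (a : A^c) *: ((b : A^c) *: v) = (b * a : A^c) *: v.
Proof. by rewrite scalerA. Qed.

Definition ract (a : A) (v : restrict M) : restrict M := (a : A^c) *: (v : M).

Fact ract_is_linear a : linear (ract a).
Proof.
move=> c u v; rewrite /ract [LHS]scalerDr; congr (_ + _).
rewrite !restrictZ !ractM; congr (_ *: _ : M).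
by rewrite -scalerAl -scalerAr mul1r mulr1.
Qed.

HB.instance Definition _ a :=
  GRing.isLinear.Build K (restrict M) (restrict M) *:%R (ract a)
    (ract_is_linear a).

End Instance.

Definition restrict_map (M N : lmodType A^c) (f : {linear M -> N}) :
  restrict M -> restrict N := f.

Fact restrict_map_is_linear (M N : lmodType A^c) (f : {linear M -> N}) :
  linear (restrict_map f).
Proof. by move=> c u v; rewrite /restrict_map linearP. Qed.

HB.instance Definition _ (M N : lmodType A^c) (f : {linear M -> N}) :=
  GRing.isLinear.Build K (restrict M) (restrict N) *:%R (restrict_map f)
    (restrict_map_is_linear f).

(** It exhibits a finitely generated module as a linear image of the finite-dimensional space [A^n],
    which bounds the dimension of its subspaces. *)
Definition span_map (M : lmodType A^c) n (g : 'I_n -> M)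
    (a : {ffun 'I_n -> A}) : restrict M := \sum_i (a i : A^c) *: g i.

Fact span_map_is_linear (M : lmodType A^c) n (g : 'I_n -> M) :
  linear (span_map g).
Proof.
move=> c a b; rewrite /span_map restrictZ scaler_sumr -big_split /=.
apply: eq_bigr => i _; rewrite !ffunE scalerDl scalerA.
congr (_ + _); congr (_ *: _ : M).
by rewrite -[RHS]/(a i * c%:A : A) -scalerAr mulr1.
Qed.

HB.instance Definition _ (M : lmodType A^c) n (g : 'I_n -> M) :=
  GRing.isLinear.Build K {ffun 'I_n -> A} (restrict M) *:%R (span_map g)
    (span_map_is_linear g).

Lemma fgmod_subspace (M : fgmod A^c) (P : restrict M -> Prop) :
  P 0 -> (forall (c : K) u v, P u -> P v -> P (c *: u + v)) ->
  exists d (g : {linear 'rV[K]_d -> restrict M}),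
    injective g /\ forall w, P w <-> exists x, g x = w.
Proof.
move=> P0 Plin; have [n [g gP]] := fgmodP M.
apply: (subspace_parametrization (f := span_map g)) => // w _.
have [a ->] := gP w; exists (finfun a : {ffun 'I_n -> A}).
by apply: eq_bigr => i _; rewrite ffunE.
Qed.

(** For [e] idempotent the fixed vectors of [ract e] form [M e], so [d] is the dimension of [M e]
    over [K]. *)
Definition comp_dim (e : A) (M : lmodType A^c) (d : nat) : Prop :=
  exists g : {linear 'rV[K]_d -> restrict M},
    injective g /\ forall v : M, ract e v = v <-> exists x, g x = v.

Lemma comp_dim_exists e (M : fgmod A^c) : exists d, comp_dim e M d.
Proof.
apply: (@fgmod_subspace M (fun v => ract e v = v)); first exact: linear0.
by move=> c u v eu ev; rewrite linearP /= eu ev.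
Qed.

Lemma comp_dim_leq e (M : fgmod A^c) d d' :
  comp_dim e M d -> comp_dim e M d' -> (d <= d')%N.
Proof.
move=> [g [g_inj gP]] [g' [_ gP']].
have := leq_dim_lift (f := g') g_inj; rewrite /dim /= mul1n; apply=> x.
by apply/gP'/gP; exists x.
Qed.

Lemma comp_dim_unique e (M : fgmod A^c) d d' :
  comp_dim e M d -> comp_dim e M d' -> d = d'.
Proof.
by move=> Md Md'; apply/eqP; rewrite eqn_leq !(@comp_dim_leq e M).
Qed.

(** Passing from [M] to [M e] is exact for [e] idempotent: a basis of [M e] lifts to vectors fixed
    by [e], and these complete the image of a basis of [N e]. *)
Lemma comp_dim_extension e (M N : fgmod A^c) (X : extension M N) d d' :
  e * e = e -> comp_dim e N d -> comp_dim e M d' ->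
  comp_dim e (ext_mid X) (d + d').
Proof.
move=> ee [gN [gN_inj gNP]] [gM [gM_inj gMP]].
pose fin : {linear restrict N -> restrict (ext_mid X)} :=
  restrict_map (ext_in X).
pose fout : {linear restrict (ext_mid X) -> restrict M} :=
  restrict_map (ext_out X).
have finE a u : fin (ract a u) = ract a (fin u) by exact: linearZ.
have foutE a u : fout (ract a u) = ract a (fout u) by exact: linearZ.
have ractee v : ract e (ract e v) = ract e (v : restrict (ext_mid X)).
  by rewrite /ract ractM ee.
have /fin_all_exists[w wP] j : exists w : restrict (ext_mid X),
    fout w = gM (delta_mx 0 j) /\ ract e w = w.
  have [w wE] := ext_out_surj X (gM (delta_mx 0 j)).
  (* Applying [e] makes the lift fixed and keeps its image, which already lies in [M e]. *)
  exists (ract e w); rewrite ractee foutE [fout w]wE; split=> //.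
  by apply/gMP; exists (delta_mx 0 j).
pose gE : {linear 'rV[K]_(d + d') -> restrict (ext_mid X)} :=
  row_comb (fun i => match split i with
                     | inl j => fin (gN (delta_mx 0 j)) | inr j => w j end).
have gEE (x : 'rV_(d + d')) :
    gE x = fin (gN (lsubmx x)) + row_comb w (rsubmx x).
  rewrite /gE /= /row_comb big_split_ord /=; congr (_ + _).
    rewrite [gN _]row_combE linear_sum; apply: eq_bigr => i _.
    by rewrite (unsplitK (inl _)) linearZ mxE.
  by apply: eq_bigr => i _; rewrite (unsplitK (inr _)) mxE.
have fout_in u : fout (fin u) = 0.
  by apply: (proj2 (@ext_exact _ _ _ X (fin u))); exists u.
have fout_w y : fout (row_comb w y) = gM y.
  rewrite [gM _]row_combE linear_sum; apply: eq_bigr => i _.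
  by rewrite linearZ /= (wP i).1.
have ract_w y : ract e (row_comb w y) = row_comb w y.
  by rewrite linear_sum; apply: eq_bigr => i _; rewrite linearZ /= (wP i).2.
have fin_inj : injective fin := @ext_in_inj _ _ _ X.
exists gE; split.
  apply: linear_inj => x; rewrite gEE => gx0.
  have r0 : rsubmx x = 0.
    apply: gM_inj; rewrite linear0 -fout_w -[LHS]add0r.
    by rewrite -(fout_in (gN (lsubmx x))) -linearD gx0 linear0.
  have l0 : lsubmx x = 0.
    by apply/gN_inj/fin_inj; rewrite !linear0 -gx0 r0 linear0 addr0.
  by rewrite -[x]hsubmxK l0 r0 row_mx0.
move=> v; split=> [ev|[x <-]]; last first.
  rewrite gEE linearD /= ract_w -finE; congr (fin _ + _).
  by apply/gNP; exists (lsubmx x).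
have /gMP[y yE] : ract e (fout v) = fout v by rewrite -foutE ev.
have vw0 : fout (v - row_comb w y) = 0 by rewrite linearB /= fout_w yE subrr.
have [u uE] := proj1 (@ext_exact _ _ _ X (v - row_comb w y)) vw0.
have /gNP[x xE] : ract e u = u.
  by apply: fin_inj; rewrite finE -[fin u]uE linearB /= ev ract_w.
exists (row_mx x y); rewrite gEE row_mxKl row_mxKr xE.
by rewrite -[fin u]uE subrK.
Qed.

End ScalarRestriction.

(** * Calculus in the Grothendieck group *)

(** With more rows than columns there is a nonzero rational vector in the left kernel; clearing
    denominators makes it integral. *)
Lemma int_row_dependence s r (E : 'M[int]_(s, r)) : (r < s)%N ->
  exists c : 'I_s -> int,
    (exists k, c k <> 0) /\ forall i, \sum_k c k * E k i = 0.
Proof.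
move=> rs; pose B : 'M[rat]_(s, r) := map_mx intr E.
have : kermx B != 0.
  rewrite -mxrank_eq0 mxrank_ker subn_eq0 -ltnNge.
  exact: leq_ltn_trans (rank_leq_col B) rs.
case/rowV0Pn => v /sub_kermxP vB v0.
(* [c] is [v] times the product [d] of all denominators, written so as to be visibly integral. *)
pose c k := numq (v 0 k) * \prod_(j | j != k) denq (v 0 j).
pose d := \prod_j denq (v 0 j).
have cE k : (c k)%:~R = d%:~R * v 0 k :> rat.
  have -> : d = denq (v 0 k) * \prod_(j | j != k) denq (v 0 j).
    by rewrite /d (bigD1 k).
  by rewrite /c !intrM numqE; ring.
exists c; split.
  apply: NNPP => c0; case/eqP: v0; apply/rowP => k; rewrite mxE.
  have /eqP : d%:~R * v 0 k = 0 :> rat.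
    rewrite -cE; suff -> : c k = 0 by [].
    by apply: NNPP => ck; apply: c0; exists k.
  rewrite mulf_eq0 intr_eq0 (negPf (_ : d != 0)) => [/eqP //|].
  by apply/prodf_neq0 => j _; rewrite denq_neq0.
move=> i; apply: (@intr_inj rat); rewrite rmorph_sum /=.
transitivity (d%:~R * (v *m B) 0 i); last by rewrite vB mxE mulr0.
rewrite mxE mulr_sumr; apply: eq_bigr => k _.
by rewrite intrM cE !mxE mulrA.
Qed.

Section K0Words.
Context {R : nzRingType}.
Implicit Types x y z w : K0_word R.

#[local] Hint Resolve K0_refl : core.

#[local] Instance K0_eq_equivalence : Equivalence (@K0_eq R).
Proof.
split; [exact: K0_refl | exact: K0_sym | exact: K0_trans].
Qed.

#[local] Instance K0_add_proper :
  Proper (@K0_eq R ==> @K0_eq R ==> @K0_eq R) (@K0_add R).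
Proof. by move=> x x' xx' y y' yy'; apply: K0_add_congr. Qed.

#[local] Instance K0_opp_proper : Proper (@K0_eq R ==> @K0_eq R) (@K0_opp R).
Proof. by move=> x x' xx'; apply: K0_opp_congr. Qed.

Lemma K0_addr0 x : K0_eq (K0_add x K0_zero) x.
Proof. by rewrite K0_addC K0_add0. Qed.

Lemma K0_addACA x y z w :
  K0_eq (K0_add (K0_add x y) (K0_add z w)) (K0_add (K0_add x z) (K0_add y w)).
Proof.
rewrite -!K0_addA; apply: K0_add_congr; first exact: K0_refl.
by rewrite !K0_addA (K0_addC y z).
Qed.

Lemma K0_addI x y z : K0_eq (K0_add x y) (K0_add x z) -> K0_eq y z.
Proof.
by move=> xyz; rewrite -(K0_add0 y) -(K0_add0 z) -(K0_addN x) -!K0_addA xyz.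
Qed.

Lemma K0_idem0 x : K0_eq x (K0_add x x) -> K0_eq x K0_zero.
Proof.
by move=> xx; apply: (@K0_addI x); rewrite -xx K0_addr0.
Qed.

(** For [M] zero, identity maps make 0 -> M -> M -> M -> 0 exact, whence [M] = [M] + [M]. *)
Lemma K0_mod_zero (M : fgmod R) : mod_zero M -> K0_eq (K0_class M) K0_zero.
Proof.
move=> M0; apply: K0_idem0.
have surj (w : M) : exists x : M, idfun x = w by exists w.
have exact0 (x : M) : idfun x = 0 <-> exists u : M, x = idfun u.
  by split=> _; [exists x | apply: M0].
exact: (K0_exact (@Extension R M M M idfun idfun (@inj_id M) surj exact0)).
Qed.

Definition K0_muln n x : K0_word R := iter n (K0_add x) K0_zero.

Lemma K0_mulnD m n x :
  K0_eq (K0_muln (m + n) x) (K0_add (K0_muln m x) (K0_muln n x)).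
Proof.
elim: m => [|m IHm] /=; first by rewrite K0_add0.
by rewrite -K0_addA -IHm.
Qed.

Definition K0_comb r (S : 'I_r -> K0_word R) (p : 'I_r -> nat) : K0_word R :=
  \big[@K0_add R/K0_zero]_i K0_muln (p i) (S i).

Lemma K0_comb0 r (S : 'I_r -> K0_word R) :
  K0_eq (K0_comb S (fun=> 0%N)) K0_zero.
Proof.
rewrite /K0_comb; elim/big_rec: _ => [|i x _ x0]; first exact: K0_refl.
by rewrite /= K0_add0.
Qed.

Lemma K0_combD r (S : 'I_r -> K0_word R) p q :
  K0_eq (K0_comb S (fun i => p i + q i)%N) (K0_add (K0_comb S p) (K0_comb S q)).
Proof.
rewrite /K0_comb; elim/big_rec3: _ => [|i x y z _ zxy].
  by rewrite K0_add0.
by rewrite K0_mulnD zxy K0_addACA.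
Qed.

Lemma K0_comb_delta r (S : 'I_r -> K0_word R) k d :
  K0_eq (K0_comb S (fun i => if i == k then d else 0%N)) (K0_muln d (S k)).
Proof.
rewrite /K0_comb.
have -> : K0_muln d (S k) =
    if k \in index_enum 'I_r then K0_muln d (S k) else K0_zero.
  by rewrite mem_index_enum.
elim: (index_enum _) (index_enum_uniq 'I_r) => [_|i s IHs] /=.
  by rewrite big_nil.
case/andP=> is_ us; rewrite big_cons inE eq_sym IHs //.
case: eqVneq is_ => [->|ki _] /=; last by rewrite K0_add0.
by move/negPf->; rewrite K0_addr0.
Qed.

(* For [f] additive on extensions, the homomorphism from the Grothendieck group
   to the integers induced by [f]. *)
Fixpoint K0_eval (f : fgmod R -> nat) x : int :=
  match x with
  | K0_zero => 0
  | K0_opp y => - K0_eval f y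
  | K0_add y z => K0_eval f y + K0_eval f z
  | K0_class M => f M
  end.

Lemma K0_eval_eq (f : fgmod R -> nat) :
  (forall (M N : fgmod R) (X : extension M N), f (ext_mid X) = f N + f M)%N ->
  forall x y, K0_eq x y -> K0_eval f x = K0_eval f y.
Proof.
move=> f_add x y; elim => {x y} //=.
- by move=> x y z _ -> _.
- by move=> x y _ ->.
- by move=> x x' y y' _ -> _ ->.
- by move=> x y z; rewrite addrA.
- by move=> x y; rewrite addrC.
- by move=> x; rewrite add0r.
- by move=> x; rewrite addNr.
- by move=> M N X; rewrite f_add.
Qed.

Lemma K0_eval_muln f n x : K0_eval f (K0_muln n x) = n%:Z * K0_eval f x.
Proof.
elim: n => [|n IHn] /=; first by rewrite mul0r.
by rewrite IHn -(addn1 n) PoszD mulrDl mul1r addrC.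
Qed.

Lemma K0_eval_mulz f c x : K0_eval f (K0_mulz c x) = c * K0_eval f x.
Proof.
case: c => n; rewrite [LHS]/=; first exact: K0_eval_muln.
by rewrite -[_ + _]/(K0_eval f (K0_muln n.+1 x)) K0_eval_muln NegzE mulNr.
Qed.

Lemma K0_eval_sum f (I : finType) (F : I -> K0_word R) :
  K0_eval f (\big[@K0_add R/K0_zero]_i F i) = \sum_i K0_eval f (F i).
Proof. exact: (big_morph (K0_eval f)). Qed.

Lemma K0_eval_comb f r (S : 'I_r -> K0_word R) (p : 'I_r -> nat) :
  K0_eval f (K0_comb S p) = \sum_i (p i)%:Z * K0_eval f (S i).
Proof.
by rewrite K0_eval_sum; apply: eq_bigr => i _; rewrite K0_eval_muln.
Qed.

(** Classes of modules have natural coefficients; a general word is a difference of two such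
    combinations, and negation swaps the two. *)
Lemma K0_comb_difference r (S : 'I_r -> K0_word R) :
  (forall M : fgmod R, exists p, K0_eq (K0_class M) (K0_comb S p)) ->
  forall x, exists p q, K0_eq (K0_add x (K0_comb S q)) (K0_comb S p).
Proof.
move=> Sgen; elim => [|x [p [q xpq]]|x [p [q xpq]] y [p' [q' ypq]]|M].
- by exists (fun=> 0%N), (fun=> 0%N); rewrite K0_add0.
- by exists q, p; rewrite -xpq K0_addA K0_addN K0_add0.
- exists (fun i => p i + p' i)%N, (fun i => q i + q' i)%N.
  by rewrite !K0_combD -xpq -ypq K0_addACA.
- have [p Mp] := Sgen M; exists p, (fun=> 0%N).
  by rewrite K0_comb0 K0_addr0.
Qed.

(** The homomorphisms induced by [f] are dual to [S], which makes [S] independent. As [S] generates,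
    a word on which they all vanish is zero, so an integer dependence between the value vectors of
    more than [r] words is a relation between the words. *)
Lemma rank_K0_basis r (S : 'I_r -> K0_word R) (f : 'I_r -> fgmod R -> nat) :
  (forall i (M N : fgmod R) (X : extension M N),
     f i (ext_mid X) = f i N + f i M)%N ->
  (forall i j, K0_eval (f i) (S j) = (i == j)) ->
  (forall M : fgmod R, exists p, K0_eq (K0_class M) (K0_comb S p)) ->
  K0_rank R r.
Proof.
move=> f_add fS Sgen.
have f_eq i := K0_eval_eq (f_add i).
have eval_comb p i : K0_eval (f i) (K0_comb S p) = p i.
  rewrite K0_eval_comb (bigD1 i) //= fS eqxx mulr1 big1 ?addr0 // => j ji.
  by rewrite fS eq_sym (negPf ji) mulr0.
split.
  exists S => c Sc0 i; have := f_eq i _ _ Sc0.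
  rewrite K0_eval_sum (bigD1 i) //= K0_eval_mulz fS eqxx mulr1 big1 ?addr0 //.
  by move=> j ji; rewrite K0_eval_mulz fS eq_sym (negPf ji) mulr0.
(* Evaluation identifies the coefficients [p] and [q], and the common combination cancels. *)
have eval0 x : (forall i, K0_eval (f i) x = 0) -> K0_eq x K0_zero.
  move=> x0; have [p [q xpq]] := K0_comb_difference Sgen x.
  apply: (@K0_addI (K0_comb S q)); rewrite K0_addr0 K0_addC xpq.
  suff -> : K0_comb S p = K0_comb S q by [].
  apply: eq_bigr => i _; congr K0_muln; apply/eqP.
  by rewrite -eqz_nat -!eval_comb -(f_eq i _ _ xpq) /= x0 add0r.
move=> s x x_indep; rewrite leqNgt; apply/negP => rs.
have [c [[k ck] cE]] :=
  int_row_dependence (\matrix_(k, i) K0_eval (f i) (x k)) rs.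
apply/ck/x_indep/eval0 => i; rewrite K0_eval_sum -[RHS](cE i).
by apply: eq_bigr => j _; rewrite K0_eval_mulz mxE.
Qed.
End K0Words.

(** * Algebras with triangular idempotents *)

Section Submodule.
Context {R : nzRingType} {M : lmodType R} {P : {pred M}}.
Context (P_closed : submod_closed P).

Definition submod_pred of submod_closed P : {pred M} := P.

HB.instance Definition _ :=
  GRing.isSubmodClosed.Build R M (submod_pred P_closed) P_closed.

Record submod := Submod {
  submod_val :> M;
  submod_valP : submod_val \in submod_pred P_closed
}.
HB.instance Definition _ := [isSub for submod_val].
HB.instance Definition _ := [Choice of submod by <:].
HB.instance Definition _ := [SubChoice_isSubLmodule of submod by <:].
End Submodule.

(** * Powers of one-dimensional modules given by characters *)

Section Twist.
Context {K : fieldType} {A : falgType K}.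

(* The d-th power of the one-dimensional module K on which A acts by the
   character chi. *)
Definition char_pow (chi : {lrmorphism A -> K^o}) (d : nat) : Type := 'rV[K]_d.

Section Instance.
Context (chi : {lrmorphism A -> K^o}) (d : nat).
Local Notation V := (char_pow chi d).

HB.instance Definition _ := GRing.Zmodule.on V.

Definition char_pow_scale (a : A^c) (v : V) : V := chi a *: (v : 'rV[K]_d).

Fact char_pow_scalerA a b v :
  char_pow_scale a (char_pow_scale b v) = char_pow_scale (a * b) v.
Proof.
rewrite /char_pow_scale scalerA; congr (_ *: _).
by rewrite -[a * b]/((b : A) * (a : A)) rmorphM mulrC.
Qed.

Fact char_pow_scale1r : left_id 1 char_pow_scale.
Proof. by move=> v; rewrite /char_pow_scale rmorph1 scale1r. Qed.

Fact char_pow_scalerDr : right_distributive char_pow_scale +%R.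
Proof. by move=> c u v; rewrite /char_pow_scale [LHS]scalerDr. Qed.

Fact char_pow_scalerDl v : {morph char_pow_scale^~ v : a b / a + b}.
Proof. by move=> a b; rewrite /char_pow_scale raddfD scalerDl. Qed.

HB.instance Definition _ := GRing.Zmodule_isLmodule.Build A^c V
  char_pow_scalerA char_pow_scale1r char_pow_scalerDr char_pow_scalerDl.

Lemma char_powZ (a : A) (v : V) :
  (a : A^c) *: v = chi a *: (v : 'rV[K]_d) :> 'rV[K]_d.
Proof. by []. Qed.

Lemma char_alg (c : K) : chi c%:A = c.
Proof. by rewrite linearZ /= rmorph1 [LHS]mulr1. Qed.

Fact char_pow_fg : finitely_generated V.
Proof.
exists d, (fun i => delta_mx 0 i) => v.
exists (fun i => ((v : 'rV[K]_d) 0 i)%:A : A^c).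
rewrite {1}[v](row_sum_delta (v : 'rV[K]_d)).
by apply: eq_bigr => i _; rewrite char_powZ char_alg.
Qed.

Definition char_fgmod : fgmod A^c := FgMod char_pow_fg.

Lemma comp_dim_char e : chi e = 0 \/ chi e = 1 ->
  comp_dim e V (if chi e == 0 then 0%N else d).
Proof.
case=> [e0|e1]; rewrite ?e0 ?e1 ?eqxx ?oner_eq0.
  exists (row_comb (fun i : 'I_0 => 0)); split.
    by move=> x y _; rewrite [x]thinmx0 [y]thinmx0.
  move=> v; rewrite /ract char_powZ e0 scale0r; split=> [<-|[x <-]].
    by exists 0; rewrite linear0.
  by rewrite [x]thinmx0 linear0.
pose g (x : 'rV[K]_d) : restrict V := x.
have g_linear : linear g.
  by move=> c x y; rewrite restrictZ [in RHS]char_powZ char_alg.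
pose gL : {linear 'rV[K]_d -> restrict V} :=
  HB.pack g (GRing.isLinear.Build _ _ _ _ g g_linear).
exists gL; split=> [x y //|v]; split=> _; first by exists v.
by rewrite /ract char_powZ e1 scale1r.
Qed.

End Instance.

(** The first coordinate is a submodule, and the remaining ones form the quotient. *)
Lemma char_fgmodS (chi : {lrmorphism A -> K^o}) d :
  K0_eq (K0_class (char_fgmod chi d.+1))
        (K0_add (K0_class (char_fgmod chi 1)) (K0_class (char_fgmod chi d))).
Proof.
pose i (u : char_fgmod chi 1) : char_fgmod chi d.+1 :=
  row_mx (u : 'rV[K]_1) (0 : 'rV[K]_d).
pose p (u : char_fgmod chi d.+1) : char_fgmod chi d :=
  rsubmx (u : 'rV[K]_(1 + d)).
have i_linear : linear i.
  move=> a u v.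
  have row_lin (c : K) (x y : 'rV[K]_1) : row_mx (c *: x + y) (0 : 'rV[K]_d) =
      c *: row_mx x 0 + row_mx y 0.
    by rewrite scale_row_mx add_row_mx scaler0 addr0.
  exact: row_lin.
have p_linear : linear p.
  have rsub_lin (c : K) (x y : 'rV[K]_(1 + d)) :
    rsubmx (c *: x + y) = c *: rsubmx x + rsubmx y by rewrite linearP.
  by move=> a u v; apply: rsub_lin.
pose iL : {linear _ -> _} :=
  HB.pack i (GRing.isLinear.Build _ _ _ _ i i_linear).
pose pL : {linear _ -> _} :=
  HB.pack p (GRing.isLinear.Build _ _ _ _ p p_linear).
have i_inj : injective iL by move=> u v /(@eq_row_mx _ _ 1 d)[].
have p_surj w : exists x, pL x = w.
  by exists (row_mx (0 : 'rV[K]_1) (w : 'rV[K]_d)); apply: row_mxKr.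
have ip x : pL x = 0 <-> exists u, x = iL u.
  split=> [x0|[u ->]]; last exact: row_mxKr.
  exists (lsubmx (x : 'rV[K]_(1 + d))).
  by rewrite -[LHS](@hsubmxK _ _ 1 d) [rsubmx _]x0.
exact: (K0_exact (Extension i_inj p_surj ip)).
Qed.

Lemma char_fgmod_K0 (chi : {lrmorphism A -> K^o}) d :
  K0_eq (K0_class (char_fgmod chi d))
        (K0_muln d (K0_class (char_fgmod chi 1))).
Proof.
elim: d => [|d IHd].
  by apply: K0_mod_zero => v; apply: thinmx0.
apply: K0_trans (char_fgmodS chi d) _.
by apply: K0_add_congr IHd; apply: K0_refl.
Qed.
End Twist.

Lemma mod_iso_sym (R : nzRingType) (M N : lmodType R) :
  mod_iso M N -> mod_iso N M.
Proof.
case=> f [g fK gK].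
have g_linear : linear g.
  by move=> a u v; apply: (can_inj fK); rewrite linearP !gK.
pose gL : {linear N -> M} :=
  HB.pack g (GRing.isLinear.Build _ _ _ _ g g_linear).
by exists gL, f.
Qed.

(* In matrix terms: [A] is upper triangular, and its diagonal entries
   [e_i A e_i] are the scalars [chi_i A = K]. *)
Record triangular_idempotents (K : fieldType) (A : falgType K) (r : nat)
    (e : 'I_r -> A) (chi : 'I_r -> {lrmorphism A -> K^o}) : Prop := {
  idem_orth : forall i j, e i * e j = if i == j then e i else 0;
  idem_sum : \sum_i e i = 1;
  idem_lower : forall (i j : 'I_r) (a : A), (j < i)%N -> e i * a * e j = 0;
  idem_diag : forall i (a : A), e i * a * e i = chi i a *: e i;
  idem_neq0 : forall i, e i != 0
}.

(** * Basicness and the rank of the Grothendieck group from triangular idempotents *)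

Section Triangular.
Context {K : fieldType} {A : falgType K} {r : nat}.
Context {e : 'I_r -> A} {chi : 'I_r -> {lrmorphism A -> K^o}}.
Hypothesis eP : triangular_idempotents e chi.

Lemma idem_idem i : e i * e i = e i.
Proof. by rewrite (idem_orth eP) eqxx. Qed.

(** Compare the coefficients of the nonzero [e i] in [e i * e j * e i]. *)
Lemma chi_idem i j : chi i (e j) = (i == j)%:R.
Proof.
have chi_inj (c d : K) : c *: e i = d *: e i -> c = d.
  move/eqP; rewrite -subr_eq0 -scalerBl scaler_eq0 (negPf (idem_neq0 eP i)).
  by rewrite orbF subr_eq0 => /eqP.
apply: chi_inj; rewrite -(idem_diag eP) (idem_orth eP).
by case: eqVneq => _; rewrite ?idem_idem ?scale1r ?mul0r ?scale0r.
Qed.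

(** A summand [f] of [e i] satisfies [f = e i * f * e i], so it is a multiple of [e i] whose
    coefficient is idempotent in [K], hence 0 or 1. *)
Lemma primitive_tri i : primitive_idempotent (e i).
Proof.
split; [exact: idem_idem | exact/eqP/(idem_neq0 eP) |].
move=> f g ff gg fg gf efg.
have ef : e i * f = f by rewrite efg mulrDl ff gf addr0.
have fe : f * e i = f by rewrite efg mulrDr ff fg addr0.
have fE : f = chi i f *: e i by rewrite -(idem_diag eP) ef fe.
have /eqP : chi i f * (chi i f - 1) = 0.
  by rewrite mulrBr mulr1 -rmorphM ff subrr.
rewrite mulf_eq0 subr_eq0 => /orP[]/eqP chif.
  by left; rewrite fE chif scale0r.
right; apply: (@addrI _ f); rewrite -efg addr0.
by rewrite [RHS]fE chif scale1r.
Qed.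

(** A homomorphism sends the generator [e i] into e_j A e_i, which is zero by triangularity. *)
Lemma eA_iso_lower (i j : 'I_r) :
  (i < j)%N -> ~ @mod_iso A^c (eA (e i)) (eA (e j)).
Proof.
move=> ij [f [g fK _]].
have ei_in : (e i : (A^c)^o) \in in_eA (e i) by rewrite inE idem_idem.
pose u := EA ei_in.
have u_ei : (e i : A^c) *: u = u by apply/val_inj; apply: idem_idem.
have fu : f u = 0.
  apply/val_inj; rewrite /= -u_ei linearZ /=.
  have fuP : e j * (eA_val (f u) : A) = eA_val (f u).
    exact/eqP/(eA_valP (f u)).
  change ((eA_val (f u) : A) * e i = 0); rewrite -fuP.
  exact: (idem_lower eP).
case/eqP: (idem_neq0 eP i).
by rewrite -[LHS]/(eA_val u) -(fK u) fu -(linear0 f) fK.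
Qed.

Lemma basic_tri : basic_algebra A.
Proof.
exists r, e; split.
  split; [exact: primitive_tri | | exact: (idem_sum eP)].
  by move=> i j /eqP/negPf ij; rewrite (idem_orth eP) ij.
move=> i j /eqP; rewrite neq_ltn => /orP[ij|ji] iso.
  exact: eA_iso_lower iso.
exact: eA_iso_lower (mod_iso_sym iso).
Qed.

Lemma fgmod_sum_comp (M : lmodType A^c) (v : restrict M) :
  v = \sum_i ract (e i) v.
Proof.
rewrite -[LHS](scale1r (v : M)) -[1 : A^c]/(1 : A) -(idem_sum eP).
by rewrite scaler_suml.
Qed.

(** Insert 1 as the sum of the [e i] between [v] and [a]: the terms with [i < k] vanish by
    hypothesis, those with [k < i] by triangularity. *)
Lemma ract_comp (k : 'I_r) (M : lmodType A^c) (a : A) (v : restrict M) :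
  (forall i : 'I_r, (i < k)%N -> ract (e i) v = 0) ->
  ract (e k) (ract a v) = (chi k a : K) *: ract (e k) v.
Proof.
move=> v0; rewrite restrictZ /ract !ractM -scalerAr mulr1 -(idem_diag eP).
rewrite -[a * e k]mul1r -(idem_sum eP) mulr_suml scaler_suml (bigD1 k) //=.
rewrite mulrA big1 ?addr0 // => i; rewrite neq_ltn => /orP[ik|ki].
  by rewrite -ractM [X in _ *: X](v0 i ik) scaler0.
by rewrite mulrA (idem_lower eP) ?scale0r.
Qed.

Section Step.
Context {k : 'I_r} {M : fgmod A^c}.
Hypothesis M_lower :
  forall (i : 'I_r) (v : restrict M), (i < k)%N -> ract (e i) v = 0.

Definition comp_ker : {pred M} := [pred v | ract (e k) v == 0].

Lemma comp_ker_closed : submod_closed comp_ker.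
Proof.
split=> [|a u v]; rewrite !inE; first by rewrite linear0.
move=> /eqP u0 /eqP v0.
rewrite -[a *: u + v]/(ract a u + v : restrict M) linearD /= v0 addr0.
by rewrite ract_comp ?u0 ?scaler0 // => i; apply: M_lower.
Qed.

(** The kernel has finite dimension over [K], and a basis over [K] generates it over [A]. *)
Lemma comp_ker_fg : finitely_generated (submod comp_ker_closed).
Proof.
have [||d [g [_ gP]]] := @fgmod_subspace _ _ M (fun v => ract (e k) v = 0).
- exact: linear0.
- by move=> c u v u0 v0; rewrite linearP /= u0 v0 scaler0 addr0.
have gi i : (g (delta_mx 0 i) : M) \in submod_pred comp_ker_closed.
  by apply/eqP/gP; exists (delta_mx 0 i).
exists d, (fun i => @Submod A^c M comp_ker comp_ker_closed _ (gi i)) => v.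
have /eqP/gP[x xv] := submod_valP v.
exists (fun i => (x 0 i)%:A : A^c); apply: val_inj; rewrite raddf_sum /=.
by rewrite -xv row_combE.
Qed.

(* [v |-> v e_k] maps [M] onto a power of the simple module of [chi_k]. *)
Lemma K0_step : exists d, K0_eq (K0_class M)
  (K0_add (K0_class (FgMod comp_ker_fg)) (K0_class (char_fgmod (chi k) d))).
Proof.
have [d [g [g_inj gP]]] := comp_dim_exists (e k) M; exists d.
have ex v : exists x, g x == ract (e k) (v : M).
  have [|x xP] := (gP (ract (e k) v)).1; last by exists x; apply/eqP.
  by rewrite /ract ractM idem_idem.
pose p (v : M) : char_fgmod (chi k) d := xchoose (ex v).
have pP v : g (p v) = ract (e k) v by apply/eqP; exact: (xchooseP (ex v)).
have p_linear : linear p.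
  move=> a u v; apply: g_inj.
  rewrite -[p (a *: u + v)]/(p (ract a u + v : restrict M)) pP linearD /=.
  rewrite ract_comp; last by move=> i; apply: M_lower.
  by rewrite -!pP -linearP.
pose pL : {linear M -> char_fgmod (chi k) d} :=
  HB.pack p (GRing.isLinear.Build _ _ _ _ p p_linear).
have p_surj w : exists x, pL x = w.
  by exists (g w); apply: g_inj; rewrite pP; apply/gP; exists w.
have p_exact x : pL x = 0 <-> exists u : FgMod comp_ker_fg, x = val u.
  split=> [x0|[u ->]].
    suff xk : x \in submod_pred comp_ker_closed by exists (Submod xk).
    by apply/eqP; rewrite -pP [p x]x0 linear0.
  apply: g_inj; rewrite pP linear0; apply/eqP; exact: submod_valP u.
exact: (K0_exact (@Extension _ _ (FgMod comp_ker_fg) M val pL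
                    val_inj p_surj p_exact)).
Qed.
End Step.

(** The components M e_i are removed in increasing order of [i], each contributing copies of the
    simple module of [chi i]; once all are gone the module is zero, since the [e i] sum to 1. *)
Lemma K0_gen (M : fgmod A^c) : exists p,
  K0_eq (K0_class M) (K0_comb (fun i => K0_class (char_fgmod (chi i) 1)) p).
Proof.
pose Q k := forall M : fgmod A^c,
  (forall (i : 'I_r) (v : restrict M), (i < k)%N -> ract (e i) v = 0) ->
  exists p,
    K0_eq (K0_class M) (K0_comb (fun i => K0_class (char_fgmod (chi i) 1)) p).
suff QrB n : Q (r - n)%N by apply: (QrB r) => i v; rewrite subnn.
elim: n => [|n IHn] {}M M_lower.
  exists (fun=> 0%N); apply: K0_trans (K0_sym (K0_comb0 _)).
  apply: K0_mod_zero => v; rewrite [v]fgmod_sum_comp big1 // => i _.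
  by apply: M_lower; rewrite subn0.
(* For [r <= n] the subtraction truncates to 0 and the condition on lower components is empty. *)
case: (leqP r n) => [rn|nr].
  by apply: IHn => i v; move/eqP: rn => ->.
have kr : (r - n.+1 < r)%N by rewrite ltn_subrL (leq_trans _ nr).
pose k := Ordinal kr.
have [d Md] := @K0_step k M M_lower.
have [|p Tp] := IHn (FgMod (comp_ker_fg (k := k) M_lower)).
  move=> i v ik; apply: val_inj; rewrite /= -[LHS]/(ract (e i) (val v : M)).
  move: ik; rewrite -(subnSK nr) ltnS leq_eqVlt => /orP[/eqP ik|];
    last exact: M_lower.
  have -> : i = k by apply: val_inj.
  by apply/eqP; apply: submod_valP v.
exists (fun i => p i + if i == k then d else 0)%N.
apply: K0_trans Md (K0_sym _); apply: K0_trans (K0_combD _ _ _) _.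
apply: K0_add_congr; first exact: K0_sym.
by apply: K0_trans (K0_comb_delta _ _ _) (K0_sym (char_fgmod_K0 _ _)).
Qed.

(** The dimensions of the M e_i are additive and dual to the simple modules of the [chi i]. *)
Lemma rk_K0_tri : rk_K0 A r.
Proof.
(* Evaluating words requires a dimension function, so one is chosen from the existence statement. *)
have dim_sig i (M : fgmod A^c) : {d | comp_dim (e i) M d}.
  exact/constructive_indefinite_description/comp_dim_exists.
pose f i M := sval (dim_sig i M).
have fP i (M : fgmod A^c) d : comp_dim (e i) M d -> f i M = d.
  by apply: comp_dim_unique; apply: svalP (dim_sig i M).
apply: (@rank_K0_basis _ r (fun i => K0_class (char_fgmod (chi i) 1)) f).
- move=> i M N X; apply: fP; apply: comp_dim_extension.
  + exact: idem_idem.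
  + exact: svalP (dim_sig i N).
  + exact: svalP (dim_sig i M).
- move=> i j; have chi_ij := chi_idem j i.
  have chi01 : chi j (e i) = 0 \/ chi j (e i) = 1.
    by rewrite chi_ij; case: eqVneq; [right | left].
  rewrite /= (fP i (char_fgmod (chi j) 1) _ (comp_dim_char 1 chi01)) chi_ij.
  by rewrite [j == i]eq_sym; case: (i == j); rewrite ?eqxx ?oner_eq0.
- exact: K0_gen.
Qed.

End Triangular.

(** * The triangular algebra and its cyclic modules *)

Section Hadamard.
Context {K : fieldType} {n : nat}.
Implicit Types x y z : 'rV[K]_n.

Definition hmul x y : 'rV[K]_n := \row_k (x 0 k * y 0 k).
End Hadamard.
Local Infix "**" := hmul (at level 40, left associativity).

(* The tuple (a, b, c, x, y, z) stands for the matrix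
   [[a, x, z], [0, b, y], [0, 0, c]] over the ring K^n. *)
Definition tri (K : fieldType) (n : nat) : Type :=
  (K^o * K^o * K^o * 'rV[K]_n * 'rV[K]_n * 'rV[K]_n)%type.

HB.instance Definition _ (K : fieldType) n := Vector.on (tri K n).

Section TriAlgebra.
Context {K : fieldType} {n : nat}.
Local Notation T := (tri K n).

Definition Tri (a b c : K) (x y z : 'rV[K]_n) : T := (a, b, c, x, y, z).

Definition tri_one : T := Tri 1 1 1 0 0 0.

Definition tri_mul (s t : T) : T :=
  let: (a, b, c, x, y, z) := s in let: (a', b', c', x', y', z') := t in
  Tri (a * a') (b * b') (c * c') (a *: x' + b' *: x) (b *: y' + c' *: y)
      (a *: z' + x ** y' + c' *: z).

Lemma tri_mulE a b c x y z a' b' c' x' y' z' :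
  tri_mul (Tri a b c x y z) (Tri a' b' c' x' y' z') =
  Tri (a * a') (b * b') (c * c') (a *: x' + b' *: x) (b *: y' + c' *: y)
      (a *: z' + x ** y' + c' *: z).
Proof. by []. Qed.

Lemma tri_addE a b c x y z a' b' c' x' y' z' :
  Tri a b c x y z + Tri a' b' c' x' y' z' =
  Tri (a + a') (b + b') (c + c') (x + x') (y + y') (z + z').
Proof. by []. Qed.

Lemma tri_scaleE k a b c x y z :
  k *: Tri a b c x y z =
  Tri (k * a) (k * b) (k * c) (k *: x) (k *: y) (k *: z).
Proof. by []. Qed.

Lemma triP (t : T) : exists a b c x y z, t = Tri a b c x y z.
Proof. by case: t => [[[[[a b] c] x] y] z]; exists a, b, c, x, y, z. Qed.

Lemma Tri_eq a b c x y z a' b' c' x' y' z' :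
  a = a' -> b = b' -> c = c' -> x = x' -> y = y' -> z = z' ->
  Tri a b c x y z = Tri a' b' c' x' y' z'.
Proof. by move=> -> -> -> -> -> ->. Qed.

Fact tri_mulA : associative tri_mul.
Proof.
move=> s t u.
have [a [b [c [x [y [z ->]]]]]] := triP s.
have [a' [b' [c' [x' [y' [z' ->]]]]]] := triP t.
have [a'' [b'' [c'' [x'' [y'' [z'' ->]]]]]] := triP u.
by rewrite !tri_mulE; apply: Tri_eq; try apply/rowP => k; rewrite ?mxE; ring.
Qed.

Fact tri_mul1 : left_id tri_one tri_mul.
Proof.
move=> s; have [a [b [c [x [y [z ->]]]]]] := triP s.
by rewrite !tri_mulE; apply: Tri_eq; try apply/rowP => k; rewrite ?mxE; ring.
Qed.

Fact tri_mulr1 : right_id tri_one tri_mul.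
Proof.
move=> s; have [a [b [c [x [y [z ->]]]]]] := triP s.
by rewrite !tri_mulE; apply: Tri_eq; try apply/rowP => k; rewrite ?mxE; ring.
Qed.

Fact tri_mulDl : left_distributive tri_mul +%R.
Proof.
move=> s t u.
have [a [b [c [x [y [z ->]]]]]] := triP s.
have [a' [b' [c' [x' [y' [z' ->]]]]]] := triP t.
have [a'' [b'' [c'' [x'' [y'' [z'' ->]]]]]] := triP u.
rewrite tri_addE !tri_mulE tri_addE.
by apply: Tri_eq; try apply/rowP => k; rewrite ?mxE; ring.
Qed.

Fact tri_mulDr : right_distributive tri_mul +%R.
Proof.
move=> s t u.
have [a [b [c [x [y [z ->]]]]]] := triP s.
have [a' [b' [c' [x' [y' [z' ->]]]]]] := triP t.
have [a'' [b'' [c'' [x'' [y'' [z'' ->]]]]]] := triP u.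
rewrite tri_addE !tri_mulE tri_addE.
by apply: Tri_eq; try apply/rowP => k; rewrite ?mxE; ring.
Qed.

Fact tri_one_neq0 : tri_one != 0.
Proof. by apply/eqP => -[/eqP]; rewrite oner_eq0. Qed.

HB.instance Definition _ := GRing.Zmodule_isNzRing.Build T
  tri_mulA tri_mul1 tri_mulr1 tri_mulDl tri_mulDr tri_one_neq0.

Lemma TriM a b c x y z a' b' c' x' y' z' :
  Tri a b c x y z * Tri a' b' c' x' y' z' =
  Tri (a * a') (b * b') (c * c') (a *: x' + b' *: x) (b *: y' + c' *: y)
      (a *: z' + x ** y' + c' *: z).
Proof. by []. Qed.

Fact tri_scaleAl (k : K) (s t : T) : k *: (s * t) = (k *: s) * t.
Proof.
have [a [b [c [x [y [z ->]]]]]] := triP s.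
have [a' [b' [c' [x' [y' [z' ->]]]]]] := triP t.
rewrite TriM !tri_scaleE !TriM.
by apply: Tri_eq; try apply/rowP => i; rewrite ?mxE; ring.
Qed.

HB.instance Definition _ := GRing.Lmodule_isLalgebra.Build K T tri_scaleAl.

Fact tri_scaleAr (k : K) (s t : T) : k *: (s * t) = s * (k *: t).
Proof.
have [a [b [c [x [y [z ->]]]]]] := triP s.
have [a' [b' [c' [x' [y' [z' ->]]]]]] := triP t.
rewrite TriM !tri_scaleE !TriM.
by apply: Tri_eq; try apply/rowP => i; rewrite ?mxE; ring.
Qed.

HB.instance Definition _ := GRing.Lalgebra_isAlgebra.Build K T tri_scaleAr.
HB.instance Definition _ := Algebra_isFalgebra.Build K T.

End TriAlgebra.

(** Send [x] to the pair formed by the preimage of [x - s (ext_out X x)] in [N] and by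
    [ext_out X x]; the inverse adds [ext_in X] and [s]. *)
Lemma ext_equiv_split (R : nzRingType) (M N : fgmod R) (X : extension M N)
    (s : {linear M -> ext_mid X}) :
  cancel s (ext_out X) -> ext_equiv X (split_extension M N).
Proof.
move=> sK.
have ex x : exists u, ext_in X u == x - s (ext_out X x).
  have [|u ->] := proj1 (@ext_exact _ _ _ X (x - s (ext_out X x))).
    by rewrite linearB /= sK subrr.
  by exists u.
pose u x := xchoose (ex x).
have uE x : ext_in X (u x) = x - s (ext_out X x).
  by apply/eqP; apply: (xchooseP (ex x)).
pose h x : fgmod_prod N M := (u x, ext_out X x).
have h_linear : linear h.
  move=> a x y; apply/pair_equal_spec; split; last exact: linearP.
  apply: (@ext_in_inj _ _ _ X); rewrite [RHS]linearP !uE !linearP.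
  by rewrite scalerDr addrACA.
pose hL : {linear ext_mid X -> fgmod_prod N M} :=
  HB.pack h (GRing.isLinear.Build _ _ _ _ h h_linear).
have out_in v : ext_out X (ext_in X v) = 0.
  by apply: (proj2 (@ext_exact _ _ _ X (ext_in X v))); exists v.
exists hL; split=> //.
  exists (fun p : N * M => ext_in X p.1 + s p.2) => [x|[v w]] /=.
    by rewrite uE subrK.
  have out_vw : ext_out X (ext_in X v + s w) = w.
    by rewrite linearD /= out_in sK add0r.
  apply/pair_equal_spec; split=> //; apply: (@ext_in_inj _ _ _ X).
  by rewrite uE out_vw addrK.
move=> v; apply/pair_equal_spec; split; last exact: out_in.
by apply: (@ext_in_inj _ _ _ X); rewrite uE out_in linear0 subr0.
Qed.

(** * Diagonal idempotents and characters of the matrix algebra *)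

Section TriIdempotents.
Context {K : fieldType} {n : nat}.
Local Notation T := (tri K n).

(** Indices start from 0: [tri_e 0], [tri_e 1], [tri_e 2] are the diagonal idempotents e_1, e_2,
    e_3. *)
Definition tri_e (i : 'I_3) : T :=
  Tri (i == 0 :> nat)%:R (i == 1 :> nat)%:R (i == 2 :> nat)%:R 0 0 0.

Definition tri_chi (i : 'I_3) (t : T) : K^o :=
  let: (a, b, c, x, y, z) := t in
  if i == 0 :> nat then a else if i == 1 :> nat then b else c.

Fact tri_chi_linear i : linear (tri_chi i).
Proof.
move=> k s t.
have [a [b [c [x [y [z ->]]]]]] := triP s.
have [a' [b' [c' [x' [y' [z' ->]]]]]] := triP t.
by rewrite /tri_chi /=; do 2!case: ifP => _ //.
Qed.

HB.instance Definition _ i :=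
  GRing.isLinear.Build K T K^o *:%R (tri_chi i) (tri_chi_linear i).

Fact tri_chi_monoid i : monoid_morphism (tri_chi i).
Proof.
split=> [|s t]; first by rewrite /tri_chi /=; do 2!case: ifP => _ //.
have [a [b [c [x [y [z ->]]]]]] := triP s.
have [a' [b' [c' [x' [y' [z' ->]]]]]] := triP t.
by rewrite TriM /tri_chi /=; do 2!case: ifP => _ //.
Qed.

HB.instance Definition _ i :=
  GRing.isMonoidMorphism.Build T K^o (tri_chi i) (tri_chi_monoid i).

Lemma tri_triangular : triangular_idempotents tri_e tri_chi.
Proof.
have row_simpl := (scale0r, scale1r, scaler0, add0r, addr0,
                   mul0r, mulr0, mul1r, mulr1).
have hmul0 (x : 'rV[K]_n) : x ** 0 = 0 by apply/rowP => k; rewrite !mxE mulr0.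
have hmul0l (x : 'rV[K]_n) : 0 ** x = 0 by apply/rowP => k; rewrite !mxE mul0r.
split.
- move=> i j; rewrite TriM !row_simpl hmul0.
  by case: i j => [[|[|[|//]]] ?] [[|[|[|//]]] ?] /=; rewrite ?row_simpl.
- rewrite !big_ord_recl big_ord0 addr0 !tri_addE /=.
  by apply: Tri_eq; rewrite ?row_simpl.
- move=> i j t; have [a [b [c [x [y [z ->]]]]]] := triP t.
  rewrite !TriM.
  by case: i j => [[|[|[|//]]] ?] [[|[|[|//]]] ?] //= _;
    rewrite ?(row_simpl, hmul0, hmul0l).
- move=> i t; have [a [b [c [x [y [z ->]]]]]] := triP t.
  rewrite !TriM tri_scaleE.
  by case: i => [[|[|[|//]]] ?] /=; rewrite ?(row_simpl, hmul0, hmul0l).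
- by move=> i; apply/eqP; case: i => [[|[|[|//]]] ?] [] /eqP; rewrite oner_eq0.
Qed.

End TriIdempotents.

(* The module [e_1 A / a_j A]: the first rows (p, u, w) of the matrices, where
   [u] and [w] have lost their coordinate [j]. *)
Definition cyc (K : fieldType) (n : nat) (j : 'I_n.+1) : Type :=
  (K * 'rV[K]_n * 'rV[K]_n)%type.

Section Cyc.
Context {K : fieldType} {n : nat}.
Implicit Type j : 'I_n.+1.
Local Notation T := (tri K n.+1).

Section Instance.
Context (j : 'I_n.+1).
Local Notation V := (@cyc K n j).
HB.instance Definition _ := GRing.Zmodule.on V.

Definition Cyc (p : K) (u w : 'rV[K]_n) : V := (p, u, w).

Lemma cycP (v : V) : exists p u w, v = Cyc p u w.
Proof. by case: v => [[p u] w]; exists p, u, w. Qed.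

Lemma Cyc_eq p u w p' u' w' :
  p = p' -> u = u' -> w = w' -> Cyc p u w = Cyc p' u' w'.
Proof. by move=> -> -> ->. Qed.

Lemma cyc_addE p u w p' u' w' :
  Cyc p u w + Cyc p' u' w' = Cyc (p + p') (u + u') (w + w').
Proof. by []. Qed.

(** The row (p, u, w) times the matrix; products in K^(n+1) are coordinatewise, so deleting
    coordinate [j] respects them. *)
Definition cyc_scale (t : T^c) (v : V) : V :=
  let: (p, u, w) := v in let: (a, b, c, x, y, z) := (t : T) in
  Cyc (p * a) (p *: col' j x + b *: u)
      (p *: col' j z + u ** col' j y + c *: w).

Lemma cyc_scaleE (a b c : K) (x y z : 'rV[K]_n.+1) p u w :
  cyc_scale (Tri a b c x y z) (Cyc p u w) =
  Cyc (p * a) (p *: col' j x + b *: u)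
      (p *: col' j z + u ** col' j y + c *: w).
Proof. by []. Qed.

Fact cyc_scalerA s t v : cyc_scale s (cyc_scale t v) = cyc_scale (s * t) v.
Proof.
rewrite -[s * t]/((t : T) * (s : T)).
have [a [b [c [x [y [z ->]]]]]] := triP (s : T).
have [a' [b' [c' [x' [y' [z' ->]]]]]] := triP (t : T).
have [p [u [w ->]]] := cycP v.
rewrite TriM !cyc_scaleE.
by apply: Cyc_eq; try apply/rowP => k; rewrite ?mxE; ring.
Qed.

Fact cyc_scale1r : left_id 1 cyc_scale.
Proof.
move=> v; have [p [u [w ->]]] := cycP v.
rewrite [1]/(Tri 1 1 1 0 0 0) cyc_scaleE.
by apply: Cyc_eq; try apply/rowP => k; rewrite ?mxE; ring.
Qed.

Fact cyc_scalerDr : right_distributive cyc_scale +%R.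
Proof.
move=> s u v.
have [a [b [c [x [y [z ->]]]]]] := triP (s : T).
have [p [u1 [u2 ->]]] := cycP u; have [q [v1 [v2 ->]]] := cycP v.
rewrite !(cyc_scaleE, cyc_addE).
by apply: Cyc_eq; try apply/rowP => k; rewrite ?mxE; ring.
Qed.

Fact cyc_scalerDl v : {morph cyc_scale^~ v : s t / s + t}.
Proof.
move=> s t.
have [a [b [c [x [y [z ->]]]]]] := triP (s : T).
have [a' [b' [c' [x' [y' [z' ->]]]]]] := triP (t : T).
have [p [u [w ->]]] := cycP v.
rewrite -[X in cyc_scale X _]/(Tri (a + a') (b + b') (c + c')
                                   (x + x') (y + y') (z + z')).
rewrite !cyc_scaleE cyc_addE.
by apply: Cyc_eq; try apply/rowP => k; rewrite ?mxE; ring.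
Qed.

HB.instance Definition _ := GRing.Zmodule_isLmodule.Build T^c V
  cyc_scalerA cyc_scale1r cyc_scalerDr cyc_scalerDl.

Lemma CycZ (a b c : K) (x y z : 'rV[K]_n.+1) p u w :
  (Tri a b c x y z : T^c) *: Cyc p u w =
  Cyc (p * a) (p *: col' j x + b *: u)
      (p *: col' j z + u ** col' j y + c *: w).
Proof. by []. Qed.

Definition cyc_gen : V := Cyc 1 0 0.

Definition row_ext (u : 'rV[K]_n) : 'rV[K]_n.+1 :=
  \row_k oapp (u 0) 0 (unlift j k).

Lemma row_extK u : col' j (row_ext u) = u.
Proof. by apply/rowP => k; rewrite !mxE liftK. Qed.

(** A representative of [v] in e_1 A, with the deleted coordinate filled by 0. *)
Definition cyc_lift (v : V) : T :=
  let: (p, u, w) := v in Tri p 0 0 (row_ext u) 0 (row_ext w).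

Lemma cyc_lift_gen v : (cyc_lift v : T^c) *: cyc_gen = v.
Proof.
have [p [u [w ->]]] := cycP v; rewrite /cyc_lift /= CycZ !row_extK.
by apply: Cyc_eq; try apply/rowP => k; rewrite ?mxE; ring.
Qed.

Definition arrow_x : T := Tri 0 0 0 (delta_mx 0 j) 0 0.

Lemma col'_delta : col' j (delta_mx 0 j) = 0 :> 'rV[K]_n.
Proof.
by apply/rowP => k; rewrite !mxE eqxx /= eq_sym (negPf (neq_lift _ _)).
Qed.

Lemma arrow_x_gen : (arrow_x : T^c) *: cyc_gen = 0.
Proof.
rewrite CycZ col'_delta.
by apply: Cyc_eq; try apply/rowP => k; rewrite ?mxE; ring.
Qed.

Lemma row_ext_col' (x : 'rV[K]_n.+1) :
  x = row_ext (col' j x) + x 0 j *: delta_mx 0 j.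
Proof.
apply/rowP => k; rewrite !mxE eqxx /=.
case: unliftP => [i|] -> /=.
  by rewrite mxE eq_sym (negPf (neq_lift _ _)) mulr0 addr0.
by rewrite eqxx mulr1 add0r.
Qed.

(** This is the presentation e_1 A / a_j A: an element of e_1 A differs from the lift of its class
    by an element of a_j A. *)
Lemma cyc_liftE p x z :
  Tri p 0 0 x 0 z = cyc_lift (Cyc p (col' j x) (col' j z)) +
    arrow_x * Tri 0 (x 0 j) 0 0 (z 0 j *: delta_mx 0 j) 0.
Proof.
rewrite /cyc_lift /= TriM tri_addE {1}[x]row_ext_col' {1}[z]row_ext_col'.
apply: Tri_eq; try apply/rowP => k; rewrite ?mxE; try ring.
by rewrite eqxx /=; case: (k == j) => /=; ring.
Qed.

Fact cyc_fg : finitely_generated V.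
Proof.
exists 1, (fun=> cyc_gen) => v; exists (fun=> cyc_lift v).
by rewrite big_ord1 cyc_lift_gen.
Qed.

Definition cyc_mod : fgmod T^c := FgMod cyc_fg.

Lemma cyc_fixed0 (v : V) :
  (tri_e 0 : T^c) *: v = v -> exists p, v = Cyc p 0 0.
Proof.
have [p [u [w ->]]] := cycP v; rewrite /tri_e CycZ /= => -[_ <- <-].
by exists p; apply: Cyc_eq; try apply/rowP => k;
  rewrite ?mxE ?(mulr0, mul0r, addr0).
Qed.

Lemma tri_e0_gen : (tri_e 0 : T^c) *: cyc_gen = cyc_gen.
Proof.
by rewrite CycZ /=; apply: Cyc_eq; try apply/rowP => k; rewrite ?mxE; ring.
Qed.

(** The component at e_1 is spanned by the generator, so the generator lies in one of the two
    summands and the other one is zero. *)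
Lemma cyc_indecomposable : indecomposable cyc_mod.
Proof.
split=> [|M1 M2 [f f_bij]].
  by move/(_ cyc_gen) => [/eqP]; rewrite oner_eq0.
have [g fK gK] := f_bij; have f_inj := can_inj fK.
have f_gen : (tri_e 0 : T^c) *: f cyc_gen = f cyc_gen.
  by rewrite -linearZ /= tri_e0_gen.
(* The first component of the generator, pulled back; being fixed by e_1, it is a multiple [p] of
   the generator. *)
pose v := g ((f cyc_gen).1, 0).
have fv : f v = ((f cyc_gen).1, 0) by rewrite gK.
have [p vE] : exists p, v = Cyc p 0 0.
  apply: cyc_fixed0; apply: f_inj; rewrite linearZ /= fv -{2}f_gen.
  by apply/pair_equal_spec; rewrite scaler0.
have vE' : v = (p%:A : T^c) *: cyc_gen.
  rewrite vE -[p%:A : T^c]/(Tri (p * 1) (p * 1) (p * 1)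
                              (p *: 0) (p *: 0) (p *: 0)) CycZ.
  by apply: Cyc_eq; try apply/rowP => k; rewrite ?mxE; ring.
have f_all m : exists t : T^c, m = t *: f cyc_gen.
  by exists (cyc_lift (g m)); rewrite -linearZ /= cyc_lift_gen gK.
move: fv; rewrite vE' linearZ /= => fv.
(* If [p = 0], the first component of the generator vanishes; if [p] is invertible, the second
   does. *)
have [p0|p_neq0] := eqVneq p 0.
  left => m1; have [t] := f_all (m1, 0).
  move=> /pair_equal_spec[-> _].
  move: fv; rewrite p0 scale0r scale0r => /pair_equal_spec[/= <- _].
  by rewrite scaler0.
right => m2; have [t /pair_equal_spec[_ ->]] := f_all (0, m2).
have /pair_equal_spec[_ /= pf2] := fv.
have pV : p%:A * p^-1%:A = 1 :> T.
  by rewrite -scalerAl mul1r scalerA mulfV // scale1r.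
suff -> : (f cyc_gen).2 = 0 by rewrite scaler0.
have <- : (p^-1%:A : T^c) *: ((p%:A : T^c) *: (f cyc_gen).2) = (f cyc_gen).2.
  by rewrite ractM pV; apply: scale1r.
by rewrite pf2 scaler0.
Qed.

End Instance.

(** * Vanishing of Hom and Ext between the cyclic modules *)

Lemma cyc_Hom_vanishes i j : i != j -> Hom_vanishes (cyc_mod j) (cyc_mod i).
Proof.
move=> ij f v.
suff f0 : f (cyc_gen j) = 0 by rewrite -(cyc_lift_gen v) linearZ /= f0 scaler0.
have [p fE] : exists p, f (cyc_gen j) = Cyc i p 0 0.
  by apply: cyc_fixed0; rewrite -linearZ /= tri_e0_gen.
have : (arrow_x j : T^c) *: f (cyc_gen j) = 0.
  by rewrite -linearZ /= arrow_x_gen linear0.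
rewrite fE CycZ => -[_ /rowP + _].
(* As [i != j], coordinate [j] survives in the module of [i], as coordinate [k], and its value there
   is [p]. *)
have [k -> _] := unlift_some ij => /(_ k).
rewrite !mxE !eqxx /= mulr1 mulr0 addr0 => ->.
by [].
Qed.

Lemma cyc_Ext1_vanishes i j : Ext1_vanishes (cyc_mod j) (cyc_mod i).
Proof.
move=> X.
have [y0 y0E] := ext_out_surj X (cyc_gen j).
have [|u uE] := proj1 (@ext_exact _ _ _ X ((arrow_x j : T^c) *: y0)).
  by rewrite linearZ /= y0E arrow_x_gen.
(* Relations satisfied by a_j under right multiplication turn into relations on [u], the preimage of
   y_0 a_j. *)
have uZ t s : arrow_x j * t = s -> (s : T^c) *: y0 = ext_in X ((t : T^c) *: u).
  by move=> <-; rewrite linearZ /= -uE ractM.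
(* From a_j e_2 = a_j follows u e_2 = u, so only the middle coordinate of [u] survives. *)
have [b ub] : exists b, u = Cyc i 0 b 0.
  have u_e1 : (tri_e 1 : T^c) *: u = u.
    apply: (@ext_in_inj _ _ _ X); rewrite -(uZ _ (arrow_x j)) //.
    by rewrite TriM /=; apply: Tri_eq; try apply/rowP => k; rewrite ?mxE; ring.
  have [p [b [w uE']]] := cycP u; exists b.
  rewrite -u_e1 uE' CycZ /=.
  by apply: Cyc_eq; try apply/rowP => k; rewrite ?mxE; ring.
(* The basis vector of index [lift i k] in position (2,3) is killed by a_j, hence by [u], and its
   product with [u] has [b 0 k] as coordinate [k]. *)
have b0 k : lift i k != j -> b 0 k = 0.
  move=> kj.
  have : (Tri 0 0 0 0 (delta_mx 0 (lift i k)) 0 : T^c) *: u = 0.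
    apply: (@ext_in_inj _ _ _ X); rewrite -(uZ _ 0) ?scale0r ?linear0 //.
    rewrite TriM; apply: Tri_eq; try apply/rowP => l; rewrite ?mxE; try ring.
    rewrite eqxx /=; case: eqVneq => [->|_] /=; last by ring.
    by rewrite eq_sym (negPf kj) /=; ring.
  rewrite ub CycZ => -[_ _ /rowP/(_ k)].
  by rewrite !mxE !eqxx /= mulr1 !mul0r add0r addr0.
(* For [i = j] this is 0, and so is [u]. *)
pose p := oapp (b 0) 0 (unlift i j).
have up : u = (arrow_x j : T^c) *: Cyc i p 0 0.
  rewrite ub CycZ; apply: Cyc_eq; first by rewrite mulr0.
    apply/rowP => k; rewrite !mxE eqxx /= mulr0 addr0.
    have [kj|kj] := eqVneq (lift i k) j; last by rewrite b0 // mulr0.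
    by rewrite /p -kj liftK mulr1.
  by apply/rowP => k; rewrite !mxE; ring.
(* [y] still lifts the generator, and the correction cancels y_0 a_j. *)
pose y := y0 - ext_in X (Cyc i p 0 0).
have y_out : ext_out X y = cyc_gen j.
  rewrite linearB /= y0E.
  suff -> : ext_out X (ext_in X (Cyc i p 0 0)) = 0 by rewrite subr0.
  apply: (proj2 (@ext_exact _ _ _ X (ext_in X (Cyc i p 0 0)))).
  by exists (Cyc i p 0 0).
have y_arrow : (arrow_x j : T^c) *: y = 0.
  by rewrite scalerBr uE -linearZ /= -up subrr.
pose s (v : cyc_mod j) : ext_mid X := (cyc_lift v : T^c) *: y.
(* Since y a_j = 0, an element of e_1 A acts on [y] through its class in the cyclic module;
   linearity of [s] rests on this. *)
have sE q x z : (Tri q 0 0 x 0 z : T^c) *: y =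
    s (Cyc j q (col' j x) (col' j z)).
  by rewrite (cyc_liftE j) scalerDl -ractM y_arrow scaler0 addr0.
have s_linear : linear s.
  move=> t v v'; rewrite [t *: s v]ractM -scalerDl.
  have [a [b' [c [x [y' [z ->]]]]]] := triP (t : T).
  have [q [v1 [v2 ->]]] := cycP v; have [q' [w1 [w2 ->]]] := cycP v'.
  (* [x'] and [z'] are the off-diagonal entries of the first row of
     [cyc_lift v * t + cyc_lift v']. *)
  pose x' := q *: x + b' *: row_ext j v1 + row_ext j w1.
  pose z' := q *: z + row_ext j v1 ** y' + c *: row_ext j v2 + row_ext j w2.
  transitivity ((Tri (q * a + q') 0 0 x' 0 z' : T^c) *: y); last first.
    congr (_ *: _); rewrite /cyc_lift /=.
    rewrite -[RHS]/(Tri q 0 0 (row_ext j v1) 0 (row_ext j v2) *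
      Tri a b' c x y' z + Tri q' 0 0 (row_ext j w1) 0 (row_ext j w2) : T).
    rewrite TriM tri_addE.
    by apply: Tri_eq; try apply/rowP => k; rewrite ?mxE; ring.
  rewrite sE CycZ; congr s.
  rewrite -[LHS]/(Cyc j (q * a + q') (q *: col' j x + b' *: v1 + w1)
      (q *: col' j z + v1 ** col' j y' + c *: v2 + w2)).
  by apply: Cyc_eq; try apply/rowP => k; rewrite ?mxE ?liftK.
pose sL : {linear cyc_mod j -> ext_mid X} :=
  HB.pack s (GRing.isLinear.Build _ _ _ _ s s_linear).
apply: (@ext_equiv_split _ _ _ _ sL) => v.
by rewrite /= /s linearZ /= y_out cyc_lift_gen.
Qed.

End Cyc.

Unset Implicit Arguments.

Theorem theorem3 (K : closedFieldType) (m : nat) (hm : (0 < m)%N) :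
  exists (A : falgType K) (s : nat) (theta : 'I_s -> rmod A) (le : rel 'I_s)
    (r : nat),
    [/\ basic_algebra A, stratifying_system theta le, rk_K0 A r
      & (m * r < s)%N].
Proof.
(* With 3m+1 coordinates there are 3m+1 cyclic modules against rank 3. *)
exists (tri K (3 * m).+1), (3 * m).+1, (@cyc_mod K (3 * m)).
exists (fun i j : 'I_(3 * m).+1 => i <= j)%N, 3.
split; [exact: basic_tri tri_triangular | | exact: rk_K0_tri tri_triangular |].
  split.
  - split=> [i|i j /anti_leq/val_inj //|j i k|i j].
    + exact: leqnn.
    + exact: leq_trans.
    + exact: leq_total.
  - by move=> i; apply: cyc_indecomposable.
  - by move=> i j _ /eqP; apply: cyc_Hom_vanishes.
  - by move=> i j _; apply: cyc_Ext1_vanishes.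
by rewrite mulnC.
Qed.
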